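(* Let $(\Omega, \mu)$ be a measure space and let $\{\tau_\alpha\}_{\alpha\in \Omega}$ be a normalized continuous Bessel family for a real Hilbert space $\mathcal{H}$. If the diagonal $\Delta := \{(\alpha, \alpha):\alpha \in \Omega\}$ is measurable in the measure space $\Omega\times \Omega$, then $$\sup_{\alpha, \beta \in \Omega,\ \alpha\neq \beta}\langle \tau_\alpha, \tau_\beta\rangle \geq \frac{-(\mu\times\mu)(\Delta)}{(\mu\times\mu)((\Omega\times\Omega)\setminus\Delta)}.$$ In particular, $$\inf_{\alpha, \beta \in \Omega,\ \alpha\neq \beta}\|\tau_\alpha-\tau_\beta\|^2\leq 2 \left(1+\frac{(\mu\times\mu)(\Delta)}{(\mu\times\mu)((\Omega\times\Omega)\setminus\Delta)}\right).$$
   Context: $\mathcal{H}$ is a real Hilbert space (it need not be finite dimensional), and $\mu\times\mu$ denotes the product measure on $\Omega\times\Omega$. A collection $\{\tau_\alpha\}_{\alpha\in\Omega}$ in $\mathcal{H}$, indexed by a measure space $(\Omega,\mu)$, is called a continuous Bessel family for $\mathcal{H}$ if: (i) for each $h\in\mathcal{H}$, the map $\Omega\ni\alpha\mapsto\langle h,\tau_\alpha\rangle\in\mathbb{R}$ is measurable; (ii) there is $b>0$ such that $\int_\Omega|\langle h,\tau_\alpha\rangle|^2\,d\mu(\alpha)\leq b\|h\|^2$ for all $h\in\mathcal{H}$. It is called normalized if $\|\tau_\alpha\|=1$ for all $\alpha\in\Omega$. *)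

(* Defs.v *)
From HB Require Import structures.
From mathcomp Require Import all_boot all_order all_algebra sesquilinear.
From mathcomp Require Import all_classical all_reals all_analysis.

Set Implicit Arguments.
Unset Strict Implicit.
Unset Printing Implicit Defensive.

Import Order.TTheory GRing.Theory Num.Theory.
Import numFieldNormedType.Exports.

Local Open Scope classical_set_scope.
Local Open Scope ring_scope.

(* A real Hilbert space is a complete normed module [H] over [R : realType],
   of arbitrary dimension, together with a positive definite symmetric bilinear
   form [ip : {dot H for idfun}] inducing the norm of [H]. *)
Definition induces_norm (R : realType) (H : completeNormedModType R)
    (ip : {dot H for idfun}) : Prop :=
  forall u : H, ip u u = `|u| ^+ 2.

Definition continuous_Bessel_family (R : realType) (H : completeNormedModType R)
    (ip : {dot H for idfun}) (d : measure_display) (Omega : measurableType d)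
    (mu : {measure set Omega -> \bar R}) (tau : Omega -> H) : Prop :=
  (forall h : H, measurable_fun [set: Omega] (fun alpha => ip h (tau alpha))) /\
  (exists2 b : R, 0 < b & forall h : H,
     (\int[mu]_(alpha in [set: Omega]) (`|ip h (tau alpha)| ^+ 2)%:E
        <= (b * `|h| ^+ 2)%:E)%E).

Definition normalized (R : realType) (H : completeNormedModType R)
    (T : Type) (tau : T -> H) : Prop :=
  forall alpha : T, `|tau alpha| = 1.

(* The library's [mu \x mu] is a measure only for sigma-finite [mu]. On an
   arbitrary measure space, a product measure is a measure on the product
   sigma-algebra with the expected values on measurable rectangles; for
   sigma-finite [mu] it is unique and is [mu \x mu] (lemmas below). *)
Definition is_product_measure (R : realType) (d : measure_display)
    (Omega : measurableType d) (mu : {measure set Omega -> \bar R})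
    (mumu : {measure set (Omega * Omega) -> \bar R}) : Prop :=
  forall A B : set Omega, measurable A -> measurable B ->
    mumu (A `*` B) = (mu A * mu B)%E.

Lemma product_measure1_is_product_measure (R : realType) (d : measure_display)
    (Omega : measurableType d)
    (mu : {sigma_finite_measure set Omega -> \bar R}) :
  is_product_measure mu (mu \x mu)%E.
Proof. by move=> A B mA mB; exact: product_measure1E. Qed.

Lemma is_product_measure_unique (R : realType) (d : measure_display)
    (Omega : measurableType d)
    (mu : {sigma_finite_measure set Omega -> \bar R})
    (mumu : {measure set (Omega * Omega) -> \bar R}) :
  is_product_measure mu mumu ->
  forall X : set (Omega * Omega), measurable X -> mumu X = (mu \x mu)%E X.
Proof. by move=> h X mX; rewrite (product_measure_unique h). Qed.

(* Main.v *)
(* If all the inner products off the diagonal are at most some r < 0, then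
   expanding the squared norm of a sum of n of the unit vectors tau x gives
   0 <= n + n (n - 1) r, so Omega is finite. Its singletons are sections of the
   diagonal, hence measurable, and the Bessel bound at tau x makes mu {x} finite.
   Expanding the squared norm of the sum of the mu {x} tau x then gives
   0 <= mumu Delta + r mumu (~ Delta), with both measures finite.
   A supremum below the (nonpositive) bound would contradict this for some r;
   no joint measurability of the Gram kernel or Fubini theorem is involved. *)

Require Import Defs.
From mathcomp Require Import all_boot all_order all_algebra sesquilinear.
From mathcomp Require Import all_classical all_reals all_analysis.
From mathcomp Require Import measurable_realfun lra.
Import Order.TTheory GRing.Theory Num.Theory.
Import numFieldNormedType.Exports.
Local Open Scope classical_set_scope.
Local Open Scope ring_scope.
Local Open Scope ereal_scope.

Set Implicit Arguments.
Unset Strict Implicit.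

Lemma sqr_normB (R : realType) (H : completeNormedModType R)
    (ip : {dot H for idfun}) (ip_norm : induces_norm ip) (u v : H) :
  (`|u - v| ^+ 2 = `|u| ^+ 2 + `|v| ^+ 2 - ip u v *+ 2)%R.
Proof.
by rewrite -!ip_norm (hnormB ip) /= expr0 mul1r.
Qed.

(** Termwise, the double sum dominates the expansion of the squared norm of
    [\sum_(x <- s) m x *: tau x]: diagonal inner products are 1, the others at most [r], and the
    weights are nonnegative. *)
Lemma gram_sum_ge0 (R : realType) (H : completeNormedModType R)
    (ip : {dot H for idfun}) (ip_norm : induces_norm ip)
    (T : eqType) (tau : T -> H) (tau1 : normalized tau) (r : R)
    (ip_le : forall x y, x != y -> (ip (tau x) (tau y) <= r)%R)
    (s : seq T) (m : T -> R) (m_ge0 : forall x, (0 <= m x)%R) :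
  (0 <= \sum_(x <- s) \sum_(y <- s) m x * m y * (if x == y then 1 else r))%R.
Proof.
apply: (@le_trans _ _ (`|(\sum_(x <- s) m x *: tau x)%R| ^+ 2)%R).
  exact: exprn_ge0.
rewrite -ip_norm linear_sumlz ler_sum// => x _.
rewrite linear_sumr ler_sum// => y _.
rewrite linearZl_LR linearZr_LR /= mulrA ler_wpM2l ?mulr_ge0//.
by case: eqVneq => [->|/ip_le//]; rewrite ip_norm tau1 expr1n.
Qed.

Lemma finite_of_ip_le_lt0 (R : realType) (H : completeNormedModType R)
    (ip : {dot H for idfun}) (ip_norm : induces_norm ip)
    (T : choiceType) (tau : T -> H) (tau1 : normalized tau) (r : R)
    (ip_le : forall x y, x != y -> (ip (tau x) (tau y) <= r)%R) :
  (r < 0)%R -> finite_set [set: T].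
Proof.
move=> r_lt0; apply: contrapT => /infinite_set_fset.
(* Nonnegativity of [n * (1 + (n - 1) * r)] forces [n <= 1 - r^-1] for [n > 0], so a finite subset
   larger than that is contradictory. *)
move=> /(_ (Num.truncn (1 - r^-1)).+1)[B _].
set n := size _ => n_gt.
have n_pos : (0 < n%:R :> R)%R by rewrite ltr0n (leq_trans _ n_gt).
have := gram_sum_ge0 ip_norm tau1 ip_le (finmap.enum_fset B) (fun=> ler01).
have rowE (x : T) : x \in finmap.enum_fset B ->
    (\sum_(y <- finmap.enum_fset B) 1 * 1 * (if x == y then 1 else r)
      = 1 + (n%:R - 1) * r)%R.
  move=> xB; rewrite (bigD1_seq x) ?finmap.fset_uniq//= eqxx !mul1r; congr (_ + _)%R.
  rewrite (eq_bigr (fun=> r)) => [|y]; last by rewrite mul1r eq_sym => /negbTE ->.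
  have : (\sum_(y <- finmap.enum_fset B) r = n%:R * r)%R.
    by rewrite big_const_seq iter_addr_0 count_predT mulr_natl.
  rewrite (bigD1_seq x) ?finmap.fset_uniq//= => sumE.
  by rewrite mulrBl mul1r -sumE addrAC subrr add0r.
rewrite (eq_big_seq _ rowE) big_const_seq iter_addr_0 count_predT -/n.
rewrite -[leRHS]mulr_natl pmulr_rge0// leNgt => /negP; apply.
suff : (1 - r^-1 < n%:R)%R.
  rewrite ltrBlDr -ltrBlDl -(ltr_nM2r r_lt0) mulVf ?lt_eqF//.
  by rewrite -subr_lt0 -mulNr opprB.
apply: (lt_le_trans (truncnS_gt _)); by rewrite ler_nat.
Qed.

Lemma measurable_singleton (d : measure_display) (T : measurableType d) :
  measurable (@diagonal T) -> forall x : T, measurable [set x].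
Proof.
move=> mD x; suff -> : [set x] = xsection diagonal x by exact: measurable_xsection.
by rewrite /xsection; apply/seteqP; split => y /=; rewrite inE /diagonal/= => ->.
Qed.

Lemma mu_singleton_lty (R : realType) (H : completeNormedModType R)
    (ip : {dot H for idfun}) (ip_norm : induces_norm ip)
    (d : measure_display) (T : measurableType d) (mu : {measure set T -> \bar R})
    (tau : T -> H) :
  continuous_Bessel_family ip mu tau -> normalized tau ->
  forall x : T, measurable [set x] -> mu [set x] < +oo.
Proof.
move=> [mip [b _ leb]] tau1 x mx.
apply: (le_lt_trans _ (ltry (b * `|tau x| ^+ 2)%R)).
apply: (le_trans _ (leb (tau x))).
(* The integrand is 1 at [x], so restricting the Bessel integral to the singleton leaves [mu
   [set x]]. *)
apply: (@le_trans _ _ (\int[mu]_(y in [set x]) (`|ip (tau x) (tau y)| ^+ 2)%:E)).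
  rewrite (eq_integral (cst 1)) ?integral_cst ?mul1e// => y.
  by rewrite inE /= => ->; rewrite ip_norm tau1 expr1n normr1 expr1n.
apply: ge0_subset_integral => //.
  apply/measurable_EFinP; apply: measurable_funX.
  exact: measurableT_comp (mip _).
Qed.

(** Every [A] is a finite disjoint union of points, and each point is a rectangle
    [[set x]]*[[set y]], so the rectangle rule determines [mumu A]. The indicator lets the diagonal
    and its complement share one index set. *)
Lemma product_measure_finite (R : realType) (d : measure_display)
    (T : measurableType d) (mu : {measure set T -> \bar R})
    (mumu : {measure set (T * T) -> \bar R}) (mumuP : is_product_measure mu mumu)
    (finT : finite_set [set: T]) (m1 : forall x : T, measurable [set x])
    (mu1 : forall x : T, mu [set x] \is a fin_num) (A : set (T * T)) :
  let s := finmap.enum_fset (fset_set [set: T]) in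
  mumu A = (\sum_(x <- s) \sum_(y <- s)
    fine (mu [set x]) * fine (mu [set y]) * ((x, y) \in A)%:R)%R%:E.
Proof.
move=> s.
have ms x : x \in s by rewrite in_fset_set ?inE.
have finA : finite_set A.
  apply: sub_finite_set (finite_setX finT finT) => p _; by split.
have set1E (x y : T) : [set (x, y)] = [set x] `*` [set y].
  by apply/seteqP; split=> [_ -> //|[? ?] [/= -> ->]].
have mA p : A p -> measurable [set p].
  by case: p => x y _; rewrite set1E; exact: measurableX.
have -> : mumu A = mumu (\bigcup_(p in A) [set p]).
  by congr (mumu _); apply/seteqP; split => [p Ap|p [q Aq ->]//]; exists p.
rewrite measure_fin_bigcup//; last first.
  by apply/trivIsetP => p q _ _ pq; apply/seteqP; split => // z [/= -> /eqP];
     rewrite (negbTE pq).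
rewrite (fsbigE [seq p <- [seq (x, y) | x <- s, y <- s] | p \in A]); last first.
- move=> [x y] Axy; rewrite mem_filter mem_set//= => /negP[].
  exact: allpairs_f.
- by move=> p; rewrite /= mem_filter => /andP[+ _]; rewrite inE.
- by rewrite filter_uniq// allpairs_uniq ?finmap.fset_uniq// => -[? ?] [? ?] _ _ [-> ->].
rewrite big_filter_cond big_mkcond big_allpairs -sumEFin; apply: eq_bigr => x _.
rewrite -sumEFin; apply: eq_bigr => y _.
rewrite andbb; case: ifPn => _; last by rewrite mulr0.
by rewrite set1E [LHS]mumuP// mulr1 EFinM !fineK.
Qed.

Lemma gram_product_measure (R : realType)
    (H : completeNormedModType R) (ip : {dot H for idfun})
    (ip_norm : induces_norm ip)
    (d : measure_display) (T : measurableType d)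
    (mu : {measure set T -> \bar R})
    (mumu : {measure set (T * T) -> \bar R})
    (mumuP : is_product_measure mu mumu)
    (tau : T -> H) (tau_Bessel : continuous_Bessel_family ip mu tau)
    (tau1 : normalized tau) (mD : measurable (@diagonal T)) (r : R)
    (ip_le : forall x y, x != y -> (ip (tau x) (tau y) <= r)%R) :
  (r < 0)%R -> exists a c : R, [/\ mumu (@diagonal T) = a%:E,
    mumu (~` @diagonal T) = c%:E & (0 <= a + r * c)%R].
Proof.
move=> r_lt0.
have finT : finite_set [set: T] := finite_of_ip_le_lt0 ip_norm tau1 ip_le r_lt0.
have m1 := measurable_singleton mD.
have mu1 x : mu [set x] \is a fin_num.
  by rewrite ge0_fin_numE// (mu_singleton_lty ip_norm tau_Bessel).
have mumuE := product_measure_finite mumuP finT m1 mu1.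
eexists; eexists; split; [exact: mumuE|exact: mumuE|].
have m_ge0 x : (0 <= fine (mu [set x]))%R by rewrite fine_ge0.
(* With weights [mu [set x]], the diagonal terms of the Gram sum add up to [a] and the others to
   [r * c]. *)
apply: le_trans (gram_sum_ge0 ip_norm tau1 ip_le _ m_ge0) _.
rewrite mulr_sumr -big_split /=; apply: ler_sum => x _.
rewrite mulr_sumr -big_split ler_sum// => y _ /=.
rewrite in_setC mulrCA -mulrDr.
have -> : ((x, y) \in @diagonal T) = (x == y).
  by apply/idP/eqP; rewrite inE.
by case: eqP => _; rewrite /= ?mulr0 ?addr0 ?add0r !mulr1.
Qed.

Theorem theorem2p2 (R : realType)
    (H : completeNormedModType R) (ip : {dot H for idfun})
    (ip_norm : induces_norm ip)
    (d : measure_display) (Omega : measurableType d)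
    (mu : {measure set Omega -> \bar R})
    (mumu : {measure set (Omega * Omega) -> \bar R})
    (mumuP : is_product_measure mu mumu)
    (tau : Omega -> H)
    (tau_Bessel : continuous_Bessel_family ip mu tau)
    (tau_normalized : normalized tau)
    (mDelta : measurable (@diagonal Omega))
    (* the quotient mumu Delta / mumu (~` Delta) is not 0 / 0 *)
    (quotient_defined :
      ~ (mumu (@diagonal Omega) = 0 /\ mumu (~` @diagonal Omega) = 0)) :
  ereal_sup [set (ip (tau p.1) (tau p.2))%:E | p in [set p | p.1 <> p.2]]
    >= (- mumu (@diagonal Omega)) / mumu (~` @diagonal Omega)
  /\
  ereal_inf [set ((`|tau p.1 - tau p.2| ^+ 2)%R)%:E | p in [set p | p.1 <> p.2]]
    <= 2%:E * (1 + mumu (@diagonal Omega) / mumu (~` @diagonal Omega)).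
Proof.
rewrite mulNe; set q := mumu _ / mumu _.
have q_ge0 : 0 <= q by rewrite mule_ge0// inve_ge0.
(* Stated for any upper bound [t], to serve twice: with the supremum itself, and with a bound
   derived from the infimum of distances. *)
have q_le (t : \bar R) :
    (forall x y, x != y -> (ip (tau x) (tau y))%:E <= t) -> - q <= t.
  move=> ip_t; rewrite leNgt; apply/negP => t_lt.
  (* A real [r] is needed although [t] may be [-oo], as for the supremum when there are no distinct
     pairs. *)
  have [r tr rq] : exists2 r : R, t <= r%:E & r%:E < - q.
    case: t t_lt {ip_t} => [r||].
    - by exists r.
    - by rewrite ltNge leey.
    - case: q q_ge0 => [v|//|//] _ _.
      by exists (- v - 1)%R; rewrite ?leNye// -EFinN lte_fin ltrBlDr ltrDl.
  have r_lt0 : (r < 0)%R.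
    by rewrite -lte_fin; apply: lt_le_trans rq _; rewrite oppe_le0.
  have ip_r x y : x != y -> (ip (tau x) (tau y) <= r)%R.
    by move=> xy; rewrite -lee_fin (le_trans (ip_t _ _ xy)).
  have [a [c [aE cE ac]]] := gram_product_measure ip_norm mumuP tau_Bessel
    tau_normalized mDelta ip_r r_lt0.
  have a_ge0 : (0 <= a)%R by rewrite -lee_fin -aE.
  have c_ge0 : (0 <= c)%R by rewrite -lee_fin -cE.
  (* The extended inverse of 0 is [+oo]. If [c = 0], then [quotient_defined] gives [a > 0], so
     [q = +oo] and no real lies below [- q]. *)
  move: quotient_defined rq; rewrite /q aE cE inver; case: eqVneq => [->|c0].
    move=> a0; rewrite gt0_muley// lte_fin lt_neqAle a_ge0 andbT eq_sym.
    by apply/eqP => a0'; apply: a0; rewrite a0'.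
  have c_gt0 : (0 < c)%R by rewrite lt_neqAle eq_sym c0.
  move=> _; rewrite -EFinM -EFinN lte_fin -mulNr ltr_pdivlMr//.
  by rewrite -subr_lt0 opprK addrC ltNge ac.
split.
  by apply: q_le => x y /eqP xy; apply: ereal_sup_ubound; exists (x, y).
case: q q_ge0 q_le => [v||//] _ q_le; last by rewrite addey// gt0_muley// leey.
rewrite leNgt; apply/negP => lt_inf.
(* The infimum may be [+oo], hence the passage to a real [w]. *)
have [w w_inf vw] : exists2 w : R, w%:E <=
    ereal_inf [set ((`|tau p.1 - tau p.2| ^+ 2)%R)%:E | p in [set p | p.1 <> p.2]]
    & (2 * (1 + v) < w)%R.
  move: lt_inf; rewrite -EFinD -EFinM; case: ereal_inf => [w|_|//].
    by exists w.
  by exists (2 * (1 + v) + 1)%R; rewrite ?leey// ltrDl.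
(* For unit vectors the squared distance is 2 minus twice the inner product, so a lower bound [w] on
   it caps the inner product at [1 - w / 2]. *)
suff : - v%:E <= (1 - w / 2)%:E by rewrite -EFinN lee_fin; lra.
apply: q_le => x y /eqP xy.
have : w%:E <= (`|tau x - tau y| ^+ 2)%:E.
  by apply: (le_trans w_inf); apply: ereal_inf_lbound; exists (x, y).
rewrite !lee_fin (sqr_normB ip_norm) !tau_normalized expr1n; lra.
Qed.
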